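(* Let $\mathbf M=(m_1,\dots,m_r)$ be any Motzkin path. Then for every $\alpha\in I_r$ and every $n\in\mathbb Z$ there is a Laurent polynomial $f$ in $2r$ variables with nonnegative integer coefficients such that $$R_{\alpha,n}=f\bigl(R_{1,m_1},\dots,R_{r,m_r},R_{1,m_1+1},\dots,R_{r,m_r+1}\bigr).$$
   Context: Fix $r\ge1$, $I_r=\{1,\dots,r\}$. Let $R_{1,0},\dots,R_{r,0},R_{1,1},\dots,R_{r,1}$ be algebraically independent indeterminates over $\mathbb Q$ and $(R_{\alpha,n})_{0\le\alpha\le r+1,n\in\mathbb Z}$ the $A_r$ $Q$-system: the unique family of nonzero elements of $\mathbb Q(R_{1,0},\dots,R_{r,1})$ with these initial values, $R_{0,n}=R_{r+1,n}=1$, and $R_{\alpha,n+1}R_{\alpha,n-1}=R_{\alpha,n}^2+R_{\alpha+1,n}R_{\alpha-1,n}$ ($\alpha\in I_r$, $n\in\mathbb Z$). A Motzkin path is $\mathbf M=(m_1,\dots,m_r)\in\mathbb Z^r$ with $|m_{\alpha+1}-m_\alpha|\le1$ for $1\le\alpha<r$; the elements $R_{\alpha,m_\alpha},R_{\alpha,m_\alpha+1}$ ($\alpha\in I_r$) then form a set of $2r$ algebraically independent generators of the same field. *)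

(* Defs.v *)
From HB Require Import structures.
From mathcomp Require Import all_boot all_order all_algebra.
Set Implicit Arguments. Unset Strict Implicit. Unset Printing Implicit Defensive.
Import Order.TTheory GRing.Theory Num.Theory.
Local Open Scope ring_scope.

(* A family R_{alpha,n}, alpha : nat (only 0..r+1 matter), n : int,
   is an A_r Q-system of nonzero elements of the field K. *)
Definition is_Qsystem (K : fieldType) (r : nat) (R : nat -> int -> K) : Prop :=
  [/\ (forall n, R 0%N n = 1),
      (forall n, R r.+1 n = 1),
      (forall a n, (1 <= a <= r)%N -> R a n != 0) &
      (forall a n, (1 <= a <= r)%N ->
          R a (n + 1) * R a (n - 1) = R a n ^+ 2 + R a.+1 n * R a.-1 n)].

Definition is_Motzkin (r : nat) (m : nat -> int) : Prop :=
  forall a, (1 <= a < r)%N -> `|m a.+1 - m a| <= 1.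

Definition seed (K : fieldType) (r : nat) (R : nat -> int -> K) (m : nat -> int)
    (i : 'I_(r + r)) : K :=
  if (i < r)%N then R i.+1 (m i.+1) else R (i - r).+1 (m (i - r).+1 + 1).

(* Polynomials in k variables with rational coefficients, of degree < d in
   each variable: coefficient function on exponent vectors. *)
Definition ratpoly (k d : nat) := {ffun {ffun 'I_k -> 'I_d} -> rat}.

Definition eval_ratpoly (K : fieldType) (k d : nat) (P : ratpoly k d)
    (x : 'I_k -> K) : K :=
  \sum_(e : {ffun 'I_k -> 'I_d}) ratr (P e) * \prod_(i < k) x i ^+ e i.

Definition alg_indep (K : fieldType) (k : nat) (x : 'I_k -> K) : Prop :=
  forall (d : nat) (P : ratpoly k d), eval_ratpoly P x = 0 -> P = 0.

(* A Laurent polynomial in k variables with nonnegative integer coefficients,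
   given as a finite list of monomials (coefficient, exponent vector in Z^k). *)
Definition nnlaurent (k : nat) := seq (nat * {ffun 'I_k -> int}).

Definition eval_nnlaurent (K : fieldType) (k : nat) (f : nnlaurent k)
    (x : 'I_k -> K) : K :=
  \sum_(mo <- f) (mo.1)%:R * \prod_(i < k) x i ^ (mo.2 i).
Arguments seed {K} r R m i.

(* Main.v *)
Require Import Defs.
From HB Require Import structures.
From mathcomp Require Import all_boot all_order all_algebra.
From mathcomp Require Import zify ring.
Import Order.TTheory GRing.Theory Num.Theory.
Set Implicit Arguments. Unset Strict Implicit. Unset Printing Implicit Defensive.
Local Open Scope ring_scope.

(**
Let two chains of integers [s] and [t], indexed by the levels [1..r], evolve by
unit moves at one level at a time, the height at level [b] being [t b - s b].
To a move of [t] at level [j] attach a lower elementary matrix, and to a move of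
[s] at level [i] an upper one, acting on the rows next to that level; their
entries are Laurent monomials in the values of [R] at the heights just before
and just after the move. The Q-system says exactly that moves of [s] and moves
of [t] commute (a flat connection), so the matrix product along a sequence of
moves depends only on its start, its moves of [s] and its moves of [t].

Starting from heights [m], alternate full rounds of [t]-moves and of [s]-moves
(Coxeter words, whose order is dictated by the Motzkin path). All heights stay
in [{m b, m b + 1}], so every factor has entries that are monomials in the seed,
and all minors of the product are Laurent positive. Doing all moves of [t] first
instead writes the same product as lower unipotent times upper triangular, so
that after [k] rounds its leading [a x a] minor is [R a (m a + k) / R a (m a)].
Heights below [m a] follow by the reflection [n -> - n], [m -> - m - 1].
*)

(** * Minors under elementary row operations *)

Section RowOperations.
Variables (K : fieldType) (a : nat).
Implicit Types (B : nat -> 'I_a -> K) (f : 'I_a -> nat).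

(** Left multiplication by an elementary matrix. [B] stands for [a] columns; its rows run over all
    of [nat], so levels serve directly as row numbers. *)
Definition row_op (k k' : nat) (y x : K) B : nat -> 'I_a -> K :=
  fun p q => if p == k then y * B k q + x * B k' q else B p q.

Definition row_minor f B : K := \det (\matrix_(p, q) B (f p) q).

Definition replace_row f (p0 : 'I_a) (k : nat) : 'I_a -> nat :=
  fun p => if p == p0 then k else f p.

Lemma eq_row_minor f B B' : B =2 B' -> row_minor f B = row_minor f B'.
Proof. by move=> eqB; congr (\det _); apply/matrixP=> p q; rewrite !mxE eqB. Qed.

Lemma row_minor_alternate f B p p' :
  p != p' -> f p = f p' -> row_minor f B = 0.
Proof.
move=> npp' eqf; apply: (determinant_alternate npp') => q.
by rewrite !mxE eqf.
Qed.

Lemma row_minor_row0 f B p : (forall q, B (f p) q = 0) -> row_minor f B = 0.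
Proof.
by move=> B0; rewrite /row_minor (expand_det_row _ p) big1 // => q _; rewrite mxE B0 mul0r.
Qed.

Lemma row_minor_op_notin f k k' y x B :
  (forall p, f p != k) -> row_minor f (row_op k k' y x B) = row_minor f B.
Proof.
move=> fk; congr (\det _); apply/matrixP=> p q; rewrite !mxE /row_op.
by rewrite (negPf (fk p)).
Qed.

Lemma row_minor_op f k k' y x B p0 : injective f -> f p0 = k ->
  row_minor f (row_op k k' y x B) =
    y * row_minor f B + x * row_minor (replace_row f p0 k') B.
Proof.
move=> injf fk; apply: (@determinant_multilinear _ _ _ _ _ p0).
- by apply/rowP=> q; rewrite !mxE /row_op /replace_row fk !eqxx.
- apply/matrixP=> p q; rewrite !mxE /row_op -fk (inj_eq injf).
  by rewrite eq_sym (negPf (neq_lift _ _)).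
- apply/matrixP=> p q; rewrite !mxE /row_op /replace_row -fk (inj_eq injf).
  by rewrite eq_sym (negPf (neq_lift _ _)).
Qed.

(** [P] abstracts a subsemiring of [K]; it will be the set of Laurent-positive values in the
    seed. *)
Variable P : K -> Prop.
Hypotheses (P0 : P 0) (P1 : P 1).
Hypothesis PD : forall x y, P x -> P y -> P (x + y).
Hypothesis PM : forall x y, P x -> P y -> P (x * y).

(** Weak rather than strict: moving one row of a strictly increasing choice to a neighbour may
    repeat a row, which only gives minor 0. *)
Definition nondecr f := forall p q : 'I_a, (p <= q)%N -> (f p <= f q)%N.

Definition pos_minors B := forall f, nondecr f -> P (row_minor f B).

Lemma row_minor_injP f B : P (row_minor f B) \/ injective f.
Proof.
case: (altP (@injectiveP _ _ f)) => [|/injectivePn[p [p' npp' eqf]]]; first by right.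
by left; rewrite (row_minor_alternate _ npp' eqf).
Qed.

(** Linearity in row [k] gives [y] times the old minor plus [x] times the one using row [k']
    instead; since [k] and [k'] differ by at most 1, the new row choice is still nondecreasing. *)
Lemma pos_minors_op k k' y x B : (k <= k'.+1)%N -> (k' <= k.+1)%N ->
  P y -> P x -> pos_minors B -> pos_minors (row_op k k' y x B).
Proof.
move=> kk' k'k Py Px PB f ndf.
have [//|injf] := row_minor_injP f (row_op k k' y x B).
have [/existsP[p0 /eqP fk]|/existsPn fk] := boolP [exists p, f p == k]; last first.
  by rewrite row_minor_op_notin //; apply: PB.
rewrite (row_minor_op _ _ _ _ injf fk).
apply: PD; apply: PM => //; apply: PB => // p q pq; rewrite /replace_row.
have strict (i j : 'I_a) : (i < j)%N -> (f i < f j)%N.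
  move=> ij; rewrite ltn_neqAle ndf ?(ltnW ij) // andbT.
  by rewrite (inj_eq injf); apply: contraTneq ij => ->; rewrite ltnn.
case: eqVneq => [Ep|np]; case: eqVneq => [Eq|nq] //; last exact: ndf.
- case: (ltngtP p0 q) => [/strict|qp|/val_inj eqq].
  + by rewrite fk => /(leq_trans k'k).
  + by subst; lia.
  + by rewrite eqq eqxx in nq.
- case: (ltngtP p p0) => [/strict|qp|/val_inj eqq].
  + by rewrite fk => ltk; rewrite -ltnS; apply: leq_trans kk'.
  + by subst; lia.
  + by rewrite eqq eqxx in np.
Qed.

Definition unit_rows : nat -> 'I_a -> K := fun p q => (p == q)%:R.

Lemma pos_minors_unit : pos_minors unit_rows.
Proof.
move=> f ndf; have [//|injf] := row_minor_injP f unit_rows.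
(* Strict monotonicity forces [p <= f p], so the selected matrix is triangular with diagonal entries
   0 or 1. *)
have ge_id n (p : 'I_a) : p = n :> nat -> (n <= f p)%N.
  elim: n p => [//|n IHn] p pn.
  have ltna : (n < a)%N by rewrite ltnW // -pn.
  apply: (leq_ltn_trans (IHn (Ordinal ltna) erefl)).
  rewrite ltn_neqAle ndf /= ?pn // andbT (inj_eq injf) -val_eqE /= pn.
  by rewrite neq_ltn ltnSn.
rewrite /row_minor -det_tr det_trig.
  apply: (big_ind P) => // p _; rewrite !mxE /unit_rows.
  by case: (_ == _).
apply/is_trig_mxP => p q pq; rewrite !mxE /unit_rows.
by rewrite (gtn_eqF (leq_trans pq (ge_id _ q erefl))).
Qed.

Lemma row_minor_unit : row_minor val unit_rows = 1.
Proof.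
rewrite -[RHS](det1 K a); congr (\det _); apply/matrixP=> p q.
by rewrite !mxE /unit_rows val_eqE.
Qed.

End RowOperations.
Arguments unit_rows {K a}.

(** * Chains, legal moves and Coxeter words *)

Section Chains.
Implicit Types (u : nat -> int) (w : seq nat) (d : nat -> bool).

Definition raise u (i : nat) : nat -> int :=
  fun b => if b == i then u b + 1 else u b.

Fixpoint raises u w := if w is i :: w' then raises (raise u i) w' else u.

(* In terms of [2 * u b + b], level [i] is a local minimum and [raise u i]
   turns it into a local maximum. *)
Definition movable r u i :=
  ((1 < i)%N -> u i.-1 = u i + 1) /\ ((i < r)%N -> u i.+1 = u i).

Fixpoint legal r u w : Prop :=
  if w is i :: w' then [/\ (1 <= i <= r)%N, movable r u i & legal r (raise u i) w']
  else True.

Definition power w k := flatten (nseq k w).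

Lemma raises_cat u w w' : raises u (w ++ w') = raises (raises u w) w'.
Proof. by elim: w u => //= i w IHw u; rewrite IHw. Qed.

Lemma legal_cat r u w w' :
  legal r u (w ++ w') <-> legal r u w /\ legal r (raises u w) w'.
Proof.
elim: w u => [|i w IHw] u /=; first by split=> [|[]].
by split=> [[? ? /IHw[]] | [[? ? ?] ?]]; last (split=> //; apply/IHw).
Qed.

Lemma raises_uniq u w b : uniq w -> raises u w b = u b + (b \in w)%:R.
Proof.
elim: w u => [|i w IHw] u /=; first by rewrite addr0.
move=> /andP[niw uw]; rewrite IHw // /raise in_cons.
by case: eqVneq => [->|]; rewrite ?(negPf niw) /= ?addr0.
Qed.

(** Only a move of level [r] gains a condition. As [r] moves at most once and [r.+1] never, it can
    be read off the initial [u]. *)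
Lemma legal_extend r u w : legal r u w -> uniq w -> (r \in w -> u r.+1 = u r) ->
  legal r.+1 u w.
Proof.
elim: w u => //= i w IHw u [ir [ml mr] lw] /andP[niw uw] ur; split; first lia.
  split=> // lti; have [/mr //|ri] := ltnP i r.
  have Ei : i = r by lia.
  by rewrite Ei; apply: ur; rewrite Ei mem_head.
apply: IHw => // rw; rewrite /raise.
have -> : (r.+1 == i) = false by lia.
have -> : (r == i) = false by apply: contraNF niw => /eqP <-.
by apply: ur; rewrite in_cons rw orbT.
Qed.

(* [d b] tells whether level [b] moves before level [b.+1]. *)
Fixpoint coxeter d n : seq nat :=
  if n is n'.+1 then if d n' then rcons (coxeter d n') n else n :: coxeter d n'
  else [::].

(** Of two adjacent levels, the one that moves first satisfies its [movable] condition towards the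
    other; once it has moved, the other does too. *)
Definition follows d r u :=
  forall b, (1 <= b < r)%N -> u b.+1 = if d b then u b else u b - 1.

Lemma mem_coxeter d n i : (i \in coxeter d n) = (1 <= i <= n)%N.
Proof.
elim: n => [|n IHn] /=; first by rewrite in_nil; lia.
by case: (d n); rewrite ?mem_rcons in_cons IHn; lia.
Qed.

Lemma coxeter_uniq d n : uniq (coxeter d n).
Proof.
elim: n => //= n IHn.
by case: (d n); rewrite ?rcons_uniq /= IHn mem_coxeter ltnn andbF.
Qed.

Lemma raises_coxeter d n u b :
  raises u (coxeter d n) b = u b + (1 <= b <= n)%N%:R.
Proof. by rewrite raises_uniq ?coxeter_uniq // mem_coxeter. Qed.

Lemma legal_coxeter d n u : follows d n u -> legal n u (coxeter d n).
Proof.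
elim: n u => //= n IHn u fu.
have fu' : follows d n u by move=> b bn; apply: fu; lia.
have fn : (0 < n)%N -> u n.+1 = if d n then u n else u n - 1.
  by move=> n0; apply: fu; lia.
case: ifP fn => dn fn.
  rewrite -cats1; apply/legal_cat; split.
    apply: legal_extend (coxeter_uniq _ _) _; first exact: IHn.
    by rewrite mem_coxeter => ?; apply: fn; lia.
  split=> //; first by rewrite leqnn.
  split=> [n0|]; last by lia.
  rewrite /= !raises_coxeter fn; last by lia.
  have -> : (1 <= n <= n)%N by lia.
  have -> : (1 <= n.+1 <= n)%N = false by lia.
  by rewrite addr0.
split=> /=; first by rewrite leqnn.
  by split=> [n0|]; [rewrite /= fn ?subrK //; lia | lia].
apply: legal_extend (coxeter_uniq _ _) _.
  apply: IHn => b bn; rewrite /raise.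
  have -> : (b.+1 == n.+1) = false by lia.
  have -> : (b == n.+1) = false by lia.
  exact: fu'.
rewrite mem_coxeter /raise eqxx => n0.
have -> : (n == n.+1) = false by lia.
by rewrite fn ?subrK //; lia.
Qed.

Lemma follows_raises d r u : follows d r u -> follows d r (raises u (coxeter d r)).
Proof.
move=> fu b br; rewrite !raises_coxeter fu //.
have -> : (1 <= b.+1 <= r)%N by lia.
have -> : (1 <= b <= r)%N by lia.
by case: (d b) => //; rewrite addrAC.
Qed.

Lemma legal_power_coxeter d r u k : follows d r u -> legal r u (power (coxeter d r) k).
Proof.
elim: k u => //= k IHk u fu; apply/legal_cat; split; first exact: legal_coxeter.
exact/IHk/follows_raises.
Qed.

Lemma raises_power_coxeter d r u k b : (1 <= b <= r)%N ->
  raises u (power (coxeter d r) k) b = u b + k%:R.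
Proof.
move=> br; elim: k u => [|k IHk] u; first by rewrite addr0.
by rewrite /= raises_cat IHk raises_coxeter br -addrA -natrD add1n.
Qed.

End Chains.

(** * The flat connection and its leading minors *)

Section Flatness.
Variables (K : fieldType) (r : nat) (R : nat -> int -> K) (a : nat).
Hypothesis hQ : is_Qsystem r R.
Implicit Types (B : nat -> 'I_a -> K) (s t u : nat -> int) (w : seq nat).

(* [t b - s b] is the height at level [b]: it goes up under [raise t] and
   down under [raise s]. *)
Definition qval s t (b : nat) : K := R b (t b - s b).

Definition lower_coef s t j : K :=
  qval s t j.+1 * qval s t j.-1 / (qval s t j * qval s (raise t j) j).

Definition upper_coef s t i : K := qval s t i / qval (raise s i) t i.

Definition lower_op s t j B := row_op j j.-1 1 (lower_coef s t j) B.

(** On rows [i.-1] and [i] this is the block with rows [(y, 1)] and [(0, y^-1)], of determinant 1,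
    written as two row operations. *)
Definition upper_op s t i B :=
  row_op i i (upper_coef s t i)^-1 0 (row_op i.-1 i (upper_coef s t i) 1 B).

Lemma qval_neq0 s t b : (b <= r.+1)%N -> qval s t b != 0.
Proof.
have [R0 Rr Rn0 _] := hQ; rewrite /qval.
case: b => [|b]; first by rewrite R0 oner_neq0.
rewrite leq_eqVlt => /orP[/eqP[->]|ltb]; first by rewrite Rr oner_neq0.
by rewrite Rn0.
Qed.

Lemma qval_raise_notl s t i b : b != i -> qval (raise s i) t b = qval s t b.
Proof. by rewrite /qval /raise => /negPf->. Qed.

Lemma qval_raise_notr s t i b : b != i -> qval s (raise t i) b = qval s t b.
Proof. by rewrite /qval /raise => /negPf->. Qed.

(** The Q-system relation at height [t i - s i]: movability of both chains puts the neighbouring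
    levels at this same height, and at the end levels 0 and [r.+1] all values are 1. *)
Lemma qval_octahedron s t i : (1 <= i <= r)%N -> movable r s i -> movable r t i ->
  qval s (raise t i) i * qval (raise s i) t i =
    qval s t i * qval (raise s i) (raise t i) i + qval s t i.+1 * qval s t i.-1.
Proof.
move=> ir [sl sr] [tl tr]; have [R0 Rr _ Q] := hQ.
have := Q i (t i - s i) ir; rewrite /qval /raise !eqxx.
have -> : t i + 1 - s i = t i - s i + 1 by ring.
have -> : t i - (s i + 1) = t i - s i - 1 by ring.
have -> : t i + 1 - (s i + 1) = t i - s i by ring.
move=> ->; rewrite expr2; congr (_ + _ * _).
- case/andP: ir sr tr => _; rewrite leq_eqVlt => /orP[/eqP->|ltr] sr tr.
    by rewrite !Rr.
  by rewrite sr ?tr.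
- case: i ir sl tl {sr tr} => [//|[|i]] ir sl tl; first by rewrite !R0.
  rewrite sl ?tl //=; congr (R _ _); ring.
Qed.

Lemma eq_row_op k k' (y x : K) B B' : B =2 B' -> row_op k k' y x B =2 row_op k k' y x B'.
Proof. by move=> eqB p q; rewrite /row_op !eqB. Qed.

Lemma eq_lower_op s t j B B' : B =2 B' -> lower_op s t j B =2 lower_op s t j B'.
Proof. by move=> eqB; apply: eq_row_op. Qed.

Lemma eq_upper_op s t i B B' : B =2 B' -> upper_op s t i B =2 upper_op s t i B'.
Proof. by move=> eqB; apply: eq_row_op; apply: eq_row_op. Qed.

Lemma upper_lower_same s t i B : (1 <= i <= r)%N -> movable r s i -> movable r t i ->
  upper_op s t i (lower_op (raise s i) t i B) =2
  lower_op s t i (upper_op s (raise t i) i B).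
Proof.
move=> ir ms mt p q; have oct := qval_octahedron ir ms mt.
case: i ir oct {ms mt} => // i ir oct.
rewrite /upper_op /lower_op /row_op /upper_coef /lower_coef /=.
rewrite (@qval_raise_notl s t i.+1 i.+2) ?(@qval_raise_notl s t i.+1 i); try lia.
(* Eliminating the product of the neighbours leaves identities in the four values at the moving
   level, one for each affected row. *)
have {oct} -> : qval s t i.+2 * qval s t i =
    qval s (raise t i.+1) i.+1 * qval (raise s i.+1) t i.+1 -
    qval s t i.+1 * qval (raise s i.+1) (raise t i.+1) i.+1.
  by rewrite oct /=; ring.
have n00 : qval s t i.+1 != 0 by rewrite qval_neq0 //; lia.
have n01 : qval s (raise t i.+1) i.+1 != 0 by rewrite qval_neq0 //; lia.
have n10 : qval (raise s i.+1) t i.+1 != 0 by rewrite qval_neq0 //; lia.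
have n11 : qval (raise s i.+1) (raise t i.+1) i.+1 != 0 by rewrite qval_neq0 //; lia.
have -> : (i == i.+1) = false by lia.
rewrite !eqxx; case: (p =P i.+1) => [_|_].
  have -> : (i.+1 == i) = false by lia.
  by field; rewrite ?n00 ?n01 ?n10 ?n11.
case: (p =P i) => // _.
by field; rewrite ?n11 ?n10.
Qed.

(** The factors share a row only if the levels are adjacent; then the scaling of that row by the
    upper factor cancels the change of the neighbour's value in [lower_coef]. *)
Lemma upper_lower_diff s t i j B : (1 <= i <= r)%N -> (1 <= j <= r)%N -> i != j ->
  upper_op s t i (lower_op (raise s i) t j B) =2
  lower_op s t j (upper_op s (raise t j) i B).
Proof.
case: i => // i; case: j => // j ir jr nij p q.
have nji : j.+1 != i.+1 by rewrite eq_sym.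
rewrite /upper_op /lower_op /row_op /upper_coef /lower_coef /=.
rewrite (qval_raise_notr s t nij) (qval_raise_notr (raise s i.+1) t nij).
rewrite (qval_raise_notl s t nji) (qval_raise_notl s (raise t j.+1) nji).
have ni : qval s t i.+1 != 0 by rewrite qval_neq0 //; lia.
have ni' : qval (raise s i.+1) t i.+1 != 0 by rewrite qval_neq0 //; lia.
have nj : qval s t j.+1 != 0 by rewrite qval_neq0 //; lia.
have nj' : qval s (raise t j.+1) j.+1 != 0 by rewrite qval_neq0 //; lia.
have [Ei|ni1] := eqVneq j.+2 i.+1.
  case: Ei => Ei; subst i.
  rewrite (@qval_raise_notl s t j.+2 j); last by lia.
  have -> : (j == j.+2) = false by lia.
  have -> : (j == j.+1) = false by lia.
  have -> : (j.+1 == j.+2) = false by lia.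
  have -> : (j.+2 == j.+1) = false by lia.
  rewrite !eqxx; case: (p =P j.+2) => [->|_].
    by have -> : (j.+2 == j.+1) = false by lia.
  case: (p =P j.+1) => // _.
  by field; rewrite ?nj ?nj' ?ni ?ni'.
rewrite (@qval_raise_notl s t i.+1 j.+2) //.
have [Ej|nj1] := eqVneq j i.+1.
  subst j; have -> : (i == i.+2) = false by lia.
  have -> : (i.+1 == i.+2) = false by lia.
  have -> : (i.+1 == i) = false by lia.
  case: (p =P i.+2) => [->|_].
    have -> : (i.+2 == i.+1) = false by lia.
    have -> : (i.+2 == i) = false by lia.
    by field; rewrite ?nj ?nj' ?ni ?ni'.
  by [].
rewrite (@qval_raise_notl s t i.+1 j) //.
have -> : (i == j.+1) = false by lia.
have -> : (i.+1 == j.+1) = false by lia.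
have -> : (j.+1 == i.+1) = false by lia.
have -> : (j.+1 == i) = false by lia.
case: (p =P j.+1) => [->|_] //.
have -> : (j.+1 == i.+1) = false by lia.
have -> : (j.+1 == i) = false by lia.
by have -> : (j == i) = false by lia.
Qed.

Lemma upper_lower_op s t i j B : (1 <= i <= r)%N -> (1 <= j <= r)%N ->
    movable r s i -> movable r t j ->
  upper_op s t i (lower_op (raise s i) t j B) =2
  lower_op s t j (upper_op s (raise t j) i B).
Proof.
move=> ir jr; have [<-|nij] := eqVneq i j; first exact: upper_lower_same.
by move=> _ _; apply: upper_lower_diff.
Qed.

(** The first letter is the leftmost factor; coefficients follow the moving chain. *)
Fixpoint lower_word s t w B :=
  if w is j :: w' then lower_op s t j (lower_word s (raise t j) w' B) else B.

Fixpoint upper_word s t w B :=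
  if w is i :: w' then upper_op s t i (upper_word (raise s i) t w' B) else B.

Lemma eq_lower_word s t w B B' : B =2 B' -> lower_word s t w B =2 lower_word s t w B'.
Proof. by move=> eqB; elim: w t => //= j w IHw t; apply: eq_lower_op. Qed.

Lemma eq_upper_word s t w B B' : B =2 B' -> upper_word s t w B =2 upper_word s t w B'.
Proof. by move=> eqB; elim: w s => //= i w IHw s; apply: eq_upper_op. Qed.

Lemma lower_word_cat s t w w' B :
  lower_word s t (w ++ w') B = lower_word s t w (lower_word s (raises t w) w' B).
Proof. by elim: w t => //= j w IHw t; rewrite IHw. Qed.

Lemma upper_word_cat s t w w' B :
  upper_word s t (w ++ w') B = upper_word s t w (upper_word (raises s w) t w' B).
Proof. by elim: w s => //= i w IHw s; rewrite IHw. Qed.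

Lemma upper_op_lower_word s t i w B : (1 <= i <= r)%N -> movable r s i -> legal r t w ->
  upper_op s t i (lower_word (raise s i) t w B) =2
  lower_word s t w (upper_op s (raises t w) i B).
Proof.
move=> ir ms; elim: w t => //= j w IHw t [jr mt lw] p q.
by rewrite upper_lower_op //; apply: eq_lower_op => {}p {}q; rewrite IHw.
Qed.

(** Flatness on a rectangle: both ways round from [(s, t)] to the opposite corner give the same
    product. *)
Lemma upper_word_lower_word s t v w B : legal r s v -> legal r t w ->
  upper_word s t v (lower_word (raises s v) t w B) =2
  lower_word s t w (upper_word s (raises t w) v B).
Proof.
move=> + lw; elim: v s => //= i v IHv s [ir ms lv] p q.
rewrite -upper_op_lower_word //; apply: eq_upper_op => {}p {}q; exact: IHv.
Qed.

Fixpoint periods k v w s t B :=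
  if k is k'.+1 then
    lower_word s t w (upper_word s (raises t w) v
      (periods k' v w (raises s v) (raises t w) B))
  else B.

(** Each [v] is carried past all later copies of [w], which straightens the staircase into two sides
    of a rectangle. *)
Lemma periods_sorted k v w s t B :
    (forall l, legal r s (power v l)) -> (forall l, legal r t (power w l)) ->
  periods k v w s t B =2
  lower_word s t (power w k) (upper_word s (raises t (power w k)) (power v k) B).
Proof.
elim: k s t => //= k IHk s t lv lw p q.
have [lv1 lv'] : legal r s v /\ forall l, legal r (raises s v) (power v l).
  by split=> [|l]; [have /legal_cat[] := lv 1 | have /legal_cat[] := lv l.+1].
have [lw1 lw'] : legal r t w /\ forall l, legal r (raises t w) (power w l).
  by split=> [|l]; [have /legal_cat[] := lw 1 | have /legal_cat[] := lw l.+1].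
rewrite lower_word_cat raises_cat upper_word_cat.
apply: eq_lower_word => {}p {}q; rewrite -(upper_word_lower_word _ lv1 (lw' k)).
by apply: eq_upper_word => {}p {}q; apply: IHk.
Qed.

(** The shape of the first [a] columns of an upper triangular matrix. *)
Definition rows_vanish B := forall p q, (a <= p)%N -> B p q = 0.

Lemma rows_vanish_upper_op s t i B : rows_vanish B -> rows_vanish (upper_op s t i B).
Proof.
move=> vB p q ap; rewrite /upper_op /row_op.
case: (p =P i) => [Ep|_]; last first.
  case: (p =P i.-1) => [Ep|_]; last exact: vB.
  by rewrite !vB ?mulr0 ?addr0 //; lia.
case: ifP => [/eqP Ei|_]; rewrite !vB ?(mulr0, addr0) //; lia.
Qed.

Lemma rows_vanish_upper_word s t w B : rows_vanish B -> rows_vanish (upper_word s t w B).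
Proof. by move=> vB; elim: w s => //= i w IHw s; apply: rows_vanish_upper_op. Qed.

Lemma minor_lower_op s t j B : (0 < j)%N ->
  row_minor val (lower_op s t j B) = row_minor val B.
Proof.
move=> j0; have [ja|aj] := ltnP j a; last first.
  by apply: row_minor_op_notin => p; rewrite neq_ltn (leq_trans (ltn_ord p) aj).
rewrite (row_minor_op _ _ _ _ val_inj (erefl : val (Ordinal ja) = j)) mul1r.
have ja' : (j.-1 < a)%N by lia.
have nj : Ordinal ja != Ordinal ja' by rewrite -val_eqE /=; lia.
rewrite [X in _ + _ * X](row_minor_alternate _ nj) ?mulr0 ?addr0 //.
by rewrite /replace_row eqxx eq_sym (negPf nj).
Qed.

Lemma minor_lower_word s t w B : legal r t w ->
  row_minor val (lower_word s t w B) = row_minor val B.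
Proof.
elim: w t => //= j w IHw t [jr _ lw]; rewrite minor_lower_op ?IHw //; lia.
Qed.

(** For [i < a] the block of determinant 1 lies inside the minor, for [i > a] outside. For [i = a]
    only its entry [y] matters, as row [a] vanishes. *)
Lemma minor_upper_op s t i B : (1 <= i <= r)%N -> rows_vanish B ->
  row_minor val (upper_op s t i B) =
    (if i == a then upper_coef s t a else 1) * row_minor val B.
Proof.
move=> ir vB; rewrite /upper_op; set y := upper_coef s t i.
have y0 : y != 0 by rewrite mulf_neq0 ?invr_eq0 ?qval_neq0 //; lia.
have [ai|ia] := ltnP a i.
  have -> : (i == a) = false by lia.
  rewrite !row_minor_op_notin ?mul1r // => p; move: (ltn_ord p) => /= ?; lia.
have ia' : (i.-1 < a)%N by lia.
have Cminor : row_minor val (row_op i.-1 i y 1 B) = y * row_minor val B.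
  rewrite (row_minor_op _ _ _ _ val_inj (erefl : val (Ordinal ia') = i.-1)) mul1r.
  move: ia; rewrite leq_eqVlt => /orP[/eqP Ei|ltia].
    rewrite [X in _ + X](@row_minor_row0 _ _ _ _ (Ordinal ia')) ?addr0 // => q.
    by rewrite /replace_row eqxx vB // Ei.
  have ni : Ordinal ia' != Ordinal ltia by rewrite -val_eqE /=; lia.
  rewrite [X in _ + X](row_minor_alternate _ ni) ?addr0 //.
  by rewrite /replace_row eqxx eq_sym (negPf ni).
move: ia; rewrite leq_eqVlt => /orP[/eqP Ei|ltia].
  rewrite row_minor_op_notin => [|p]; first by rewrite Cminor /y Ei eqxx.
  by move: (ltn_ord p) => /= ?; lia.
rewrite (row_minor_op _ _ _ _ val_inj (erefl : val (Ordinal ltia) = i)) mul0r addr0.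
have -> : (i == a) = false by lia.
by rewrite Cminor mulKf // mul1r.
Qed.

(** Only moves at level [a] contribute, and their ratios telescope. *)
Lemma minor_upper_word s t w B : (1 <= a <= r)%N -> legal r s w -> rows_vanish B ->
  row_minor val (upper_word s t w B) =
    qval s t a / qval (raises s w) t a * row_minor val B.
Proof.
move=> ar; have n0 s' : qval s' t a != 0 by rewrite qval_neq0 //; lia.
elim: w s => [|i w IHw] s /=; first by rewrite divff // mul1r.
move=> [ir _ lw] vB; rewrite minor_upper_op //; last exact: rows_vanish_upper_word.
rewrite IHw // mulrA; congr (_ * _); rewrite /upper_coef.
case: eqVneq => [->|nia]; first by field; rewrite !n0.
by rewrite mul1r [qval (raise s i) t a]qval_raise_notl // eq_sym.
Qed.

Lemma minor_periods k v w s t : (1 <= a <= r)%N ->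
    (forall l, legal r s (power v l)) -> (forall l, legal r t (power w l)) ->
  row_minor val (periods k v w s t unit_rows) =
    qval s (raises t (power w k)) a /
    qval (raises s (power v k)) (raises t (power w k)) a.
Proof.
move=> ar lv lw; rewrite (eq_row_minor _ (periods_sorted k unit_rows lv lw)).
rewrite minor_lower_word // minor_upper_word // ?row_minor_unit ?mulr1 //.
by move=> p q ap; rewrite /unit_rows gtn_eqF // (leq_trans (ltn_ord q)).
Qed.

End Flatness.

(** * Positivity along the staircase *)

Section Positivity.
Variables (K : fieldType) (r : nat) (R : nat -> int -> K) (a : nat) (m : nat -> int).
Hypothesis hQ : is_Qsystem r R.
Variable P : K -> Prop.
Hypotheses (P0 : P 0) (P1 : P 1).
Hypothesis PD : forall x y, P x -> P y -> P (x + y).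
Hypothesis PM : forall x y, P x -> P y -> P (x * y).
Hypothesis PR : forall b n, (1 <= b <= r)%N -> n = m b \/ n = m b + 1 ->
  P (R b n) /\ P (R b n)^-1.
Implicit Types (B : nat -> 'I_a -> K) (s t : nat -> int) (w : seq nat).

Definition on_surface s t := forall b, (1 <= b <= r)%N ->
  t b - s b = m b \/ t b - s b = m b + 1.

Lemma pos_qval s t b : on_surface s t -> (b <= r.+1)%N ->
  P (qval R s t b) /\ P (qval R s t b)^-1.
Proof.
have [R0 Rr _ _] := hQ; move=> st; rewrite /qval.
case: b => [|b]; first by rewrite R0 invr1.
rewrite leq_eqVlt => /orP[/eqP[->]|ltb]; first by rewrite Rr invr1.
by apply: PR; [lia | apply: st; lia].
Qed.

(** Each level of [w] moves once, from height [m j] to [m j + 1], so only seed values or 1 occur in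
    [lower_coef]. *)
Lemma pos_lower_word s t w B : on_surface s t -> uniq w ->
    (forall j, j \in w -> (1 <= j <= r)%N /\ t j - s j = m j) ->
  pos_minors P B -> pos_minors P (lower_word R s t w B).
Proof.
elim: w t => //= j w IHw t st /andP[njw uw] wP PB.
have [jr tj] := wP j (mem_head _ _).
have st' : on_surface s (raise t j).
  move=> b br; rewrite /raise; case: eqVneq => [->|_]; last exact: st.
  by right; rewrite -tj; ring.
apply: pos_minors_op => //; try lia.
  rewrite /lower_coef invfM; apply: PM; apply: PM.
  - by have [] := pos_qval (b := j.+1) st; first lia.
  - by have [] := pos_qval (b := j.-1) st; first lia.
  - by have [] := pos_qval (b := j) st; first lia.
  - by have [] := pos_qval (b := j) st'; first lia.
apply: IHw => // i iw; have [|ir ti] := wP i; first by rewrite in_cons iw orbT.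
by rewrite /raise (negPf (memPn njw _ iw)).
Qed.

Lemma pos_upper_word s t w B : on_surface s t -> uniq w ->
    (forall i, i \in w -> (1 <= i <= r)%N /\ t i - s i = m i + 1) ->
  pos_minors P B -> pos_minors P (upper_word R s t w B).
Proof.
elim: w s => //= i w IHw s st /andP[niw uw] wP PB.
have [ir ti] := wP i (mem_head _ _).
have st' : on_surface (raise s i) t.
  move=> b br; rewrite /raise; case: eqVneq => [->|_]; last exact: st.
  by left; rewrite opprD addrA ti addrK.
have [|Pq Pq'] := pos_qval (b := i) st; try lia.
have [|Pr Pr'] := pos_qval (b := i) st'; try lia.
apply: pos_minors_op => //; try lia.
  by rewrite /upper_coef invfM invrK; apply: PM.
apply: pos_minors_op => //; try lia; first exact: PM.
apply: IHw => // j jw; have [|jr tj] := wP j; first by rewrite in_cons jw orbT.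
by rewrite /raise (negPf (memPn niw _ jw)).
Qed.

Lemma pos_periods d d' k s t B :
    (forall b, (1 <= b <= r)%N -> t b - s b = m b) ->
  pos_minors P B -> pos_minors P (periods R k (coxeter d r) (coxeter d' r) s t B).
Proof.
move=> + PB; elim: k s t => //= k IHk s t st.
apply: pos_lower_word; rewrite ?coxeter_uniq //.
- by move=> b br; left; apply: st.
- by move=> j; rewrite mem_coxeter => jr; rewrite st.
have st1 b : (1 <= b <= r)%N -> raises t (coxeter d' r) b - s b = m b + 1.
  by move=> br; rewrite raises_coxeter br -(st b br) addrAC.
apply: pos_upper_word; rewrite ?coxeter_uniq //.
- by move=> b br; right; apply: st1.
- by move=> j; rewrite mem_coxeter => jr; rewrite st1.
apply: IHk => b br; rewrite !raises_coxeter br -(st b br) /=; ring.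
Qed.

Fixpoint chain (d : nat -> bool) (b : nat) : int :=
  if b is b'.+1 then if d b' then chain d b' else chain d b' - 1 else 0.

Lemma pos_Qsystem_above k : is_Motzkin r m -> (1 <= a <= r)%N -> P (R a (m a + k%:R)).
Proof.
move=> hM ar.
(* A step of [m] by 1, 0 or -1 is split as a step of [t] minus a step of [s], each 0 or -1; the
   Motzkin condition makes this possible. *)
pose d' b := m b <= m b.+1; pose d b := m b.+1 <= m b.
pose t := chain d'; pose s b := t b - m b.
have ft : follows d' r t by [].
have fs : follows d r s.
  move=> b br; have := hM b br; rewrite /s /t /= /d /d'.
  by case: ifP; case: ifP; lia.
have st b : (1 <= b <= r)%N -> t b - s b = m b by rewrite /s; lia.
have lv l := legal_power_coxeter l fs; have lw l := legal_power_coxeter l ft.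
have := minor_periods hQ k ar lv lw.
set D := row_minor _ _; rewrite /qval !raises_power_coxeter //.
(* Before the moves of [s] the height at [a] is [m a + k]; after them it is back to [m a]. *)
have -> : t a + k%:R - s a = m a + k%:R by rewrite -(st a ar) addrAC.
have -> : t a + k%:R - (s a + k%:R) = m a by rewrite -(st a ar); ring.
have [_ _ Rn0 _] := hQ => ED.
have -> : R a (m a + k%:R) = D * R a (m a) by rewrite ED divfK ?Rn0.
apply: PM; last by apply: (PR ar _).1; left.
by apply: pos_periods => //; apply: pos_minors_unit.
Qed.

End Positivity.

(** * Heights below the path, by reflection *)

Lemma reflect_Qsystem (K : fieldType) r (R : nat -> int -> K) :
  is_Qsystem r R -> is_Qsystem r (fun b n => R b (- n)).
Proof.
move=> [R0 Rr Rn0 Q]; split=> // [a n ar|a n ar]; first exact: Rn0.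
by rewrite -Q // mulrC opprB opprD addrC [- n - 1]addrC.
Qed.

Lemma pos_Qsystem (K : fieldType) (r : nat) (R : nat -> int -> K) (m : nat -> int)
    (P : K -> Prop) : is_Qsystem r R -> is_Motzkin r m -> P 0 -> P 1 ->
    (forall x y, P x -> P y -> P (x + y)) -> (forall x y, P x -> P y -> P (x * y)) ->
    (forall b n, (1 <= b <= r)%N -> n = m b \/ n = m b + 1 -> P (R b n) /\ P (R b n)^-1) ->
  forall a n, (1 <= a <= r)%N -> P (R a n).
Proof.
move=> hQ hM P0 P1 PD PM PR a n ar; have [le_mn|lt_nm] := leP (m a) n.
  have -> : n = m a + (absz (n - m a))%:R by lia.
  exact: (pos_Qsystem_above hQ P0 P1 PD PM PR).
(* The shift by 1 makes the heights [m' b] and [m' b + 1] the negatives of [m b + 1] and [m b], so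
   the seed is preserved. *)
pose m' b := - m b - 1.
have hM' : is_Motzkin r m' by move=> b br; have := hM b br; rewrite /m'; lia.
have -> : n = - (m' a + (absz (- n - m' a))%:R) by rewrite /m'; lia.
apply: (pos_Qsystem_above (reflect_Qsystem hQ) P0 P1 PD PM _ _ hM' ar).
by move=> b i br ib; apply: PR => //; rewrite /m' in ib; lia.
Qed.

(** * The semiring of Laurent-positive values *)

Section LaurentSemiring.
Variables (K : fieldType) (k : nat) (x : 'I_k -> K).
Hypothesis x0 : forall i, x i != 0.

Definition nn_value (y : K) := exists f : nnlaurent k, y = eval_nnlaurent f x.

Lemma nn_value0 : nn_value 0.
Proof. by exists [::]; rewrite /eval_nnlaurent big_nil. Qed.

Lemma nn_value_monomial (e : {ffun 'I_k -> int}) : nn_value (\prod_i x i ^ e i).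
Proof. by exists [:: (1%N, e)]; rewrite /eval_nnlaurent big_seq1 mul1r. Qed.

Lemma nn_value1 : nn_value 1.
Proof.
have := nn_value_monomial [ffun => 0].
by rewrite big1 // => i _; rewrite ffunE expr0z.
Qed.

Lemma nn_valueX i (e : int) : nn_value (x i ^ e).
Proof.
have := nn_value_monomial [ffun j => if j == i then e else 0].
rewrite (bigD1 i) //= ffunE eqxx big1 ?mulr1 // => j nji.
by rewrite ffunE (negPf nji) expr0z.
Qed.

Lemma nn_valueD y z : nn_value y -> nn_value z -> nn_value (y + z).
Proof.
by move=> [f ->] [g ->]; exists (f ++ g); rewrite /eval_nnlaurent big_cat.
Qed.

Lemma nn_valueM y z : nn_value y -> nn_value z -> nn_value (y * z).
Proof.
move=> [f ->] [g ->].
pose mul (u v : nat * {ffun 'I_k -> int}) : nat * {ffun 'I_k -> int} :=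
  ((u.1 * v.1)%N, [ffun i => u.2 i + v.2 i]).
exists [seq mul u v | u <- f, v <- g].
rewrite /eval_nnlaurent big_allpairs_dep big_distrl; apply: eq_bigr => u _.
rewrite big_distrr; apply: eq_bigr => v _ /=.
rewrite natrM mulrACA -big_split /=; congr (_ * _); apply: eq_bigr => i _.
by rewrite ffunE expfzDr.
Qed.

End LaurentSemiring.

Theorem mainTheorem14 (r : nat) (hr : (1 <= r)%N)
    (K : fieldType) (R : nat -> int -> K)
    (hQ : is_Qsystem r R)
    (hindep : alg_indep (seed r R (fun _ => 0)))
    (m : nat -> int) (hM : is_Motzkin r m)
    (a : nat) (ha : (1 <= a <= r)%N) (n : int) :
  exists f : nnlaurent (r + r), R a n = eval_nnlaurent f (seed r R m).
Proof.
have seed_neq0 i : seed r R m i != 0.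
  have [_ _ Rn0 _] := hQ; rewrite /seed; have := ltn_ord i.
  by case: ifP => ir ltir; apply: Rn0; lia.
apply: (@pos_Qsystem K r R m (nn_value (seed r R m))) => //.
- exact: nn_value0.
- exact: nn_value1.
- exact: nn_valueD.
- exact: nn_valueM.
(* Seed values and their inverses are monomials. Height [m b] sits at index [b.-1], height [m b + 1]
   at index [r + b.-1]. *)
move=> b i br bi; have [j ->] : exists j, R b i = seed r R m j.
  have [b' Eb] : exists b', b = b'.+1 by exists b.-1; lia.
  case: bi => ->.
    have jr : (b' < r + r)%N by lia.
    by exists (Ordinal jr); rewrite /seed /= Eb; have -> : (b' < r)%N by lia.
  have jr : (r + b' < r + r)%N by lia.
  exists (Ordinal jr); rewrite /seed /= Eb addKn.
  by have -> : (r + b' < r)%N = false by lia.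
by split; [have := nn_valueX (seed r R m) j 1 | have := nn_valueX (seed r R m) j (-1)].
Qed.
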